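(* Let $E$ and $\Theta$ be sets. For $i\in\Theta$ let $M_i$ be a matroid on $E$ which is the direct sum of a finitary and a cofinitary matroid, and let $P_i,R_i\subseteq E$. For $e\in E$ let $N_e$ be a matroid on $\Theta$ which is the direct sum of a finitary and a cofinitary matroid. Then there are sets $T_i\subseteq P_i\cup R_i$ for $i\in\Theta$ such that (1) $\mathsf{span}_{M_i}(T_i)\supseteq P_i$ for every $i\in\Theta$; (2) $\mathsf{span}_{M_i^{*}}(E\setminus T_i)\supseteq E\setminus R_i$ for every $i\in\Theta$; (3) for every $e\in E$, the set $\{i\in\Theta: e\in T_i\}$ spans $\{i\in\Theta: e\in R_i\}$ in $N_e$; (4) for every $e\in E$, the set $\{i\in\Theta: e\notin T_i\}$ spans $\{i\in\Theta: e\notin P_i\}$ in $N_e^{*}$.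
   Context: Matroids may be infinite: a matroid $M=(E,\mathcal{I}_M)$ on a (possibly infinite) set $E$ is a family $\mathcal{I}_M\subseteq\mathcal{P}(E)$ of ''independent'' sets such that (I) $\varnothing\in\mathcal{I}_M$; (II) $\mathcal{I}_M$ is downward closed; (III) for all $I,J\in\mathcal{I}_M$ with $J$ $\subseteq$-maximal in $\mathcal{I}_M$ and $I$ not, there is $e\in J\setminus I$ with $I+e\in\mathcal{I}_M$; (IV) for every $X\subseteq E$, every $I\in\mathcal{I}_M\cap\mathcal{P}(X)$ extends to a $\subseteq$-maximal element of $\mathcal{I}_M\cap\mathcal{P}(X)$. Bases are maximal independent sets, circuits are minimal dependent sets. The dual $M^*$ is the matroid on the same ground set whose bases are the complements of the bases of $M$. $M$ is finitary if all its circuits are finite and cofinitary if $M^*$ is finitary. ''Direct sum of a finitary and a cofinitary matroid'' means the ground set splits into two parts with $M$ the direct sum of a finitary matroid on one and a cofinitary matroid on the other (equivalently every component of $M$ is finitary or cofinitary). For $X$ a subset of the ground set, $\mathsf{span}_M(X)$ is the set of elements $e$ such that $e\in X$ or there is a circuit $C\ni e$ of $M$ with $C-e\subseteq X$; ''$X$ spans $Y$ in $M$'' means $Y\subseteq\mathsf{span}_M(X)$. *)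

(* Defs.v *)
From mathcomp Require Import all_boot.
From mathcomp Require Import boolp classical_sets functions cardinality.

Set Implicit Arguments.
Unset Strict Implicit.
Unset Printing Implicit Defensive.

Local Open Scope classical_set_scope.

Definition maximal_set (T : Type) (F : set (set T)) (I : set T) : Prop :=
  F I /\ forall J, F J -> I `<=` J -> J = I.

Definition minimal_set (T : Type) (F : set (set T)) (I : set T) : Prop :=
  F I /\ forall J, F J -> J `<=` I -> J = I.

(* Possibly infinite matroids.  The ground set is a subset of a type, and not
   the whole type, so that the summands of a direct sum live over the same
   type as the sum. *)
Record matroid (T : Type) (E : set T) := Matroid {
  indep : set (set T);
  indep_ground : forall I, indep I -> I `<=` E;
  indep_set0 : indep set0;
  indep_subset : forall I J, indep J -> I `<=` J -> indep I;
  indep_augment : forall I J, indep I -> ~ maximal_set indep I ->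
    maximal_set indep J -> exists e, (J `\` I) e /\ indep (e |` I);
  indep_extend : forall X I, X `<=` E -> indep I -> I `<=` X ->
    exists J, I `<=` J /\ maximal_set [set K | indep K /\ K `<=` X] J }.

Definition base (T : Type) (E : set T) (M : matroid E) (B : set T) : Prop :=
  maximal_set (indep M) B.

Definition dependent (T : Type) (E : set T) (M : matroid E) (D : set T) : Prop :=
  D `<=` E /\ ~ indep M D.

Definition circuit (T : Type) (E : set T) (M : matroid E) (C : set T) : Prop :=
  minimal_set (dependent M) C.

Definition span (T : Type) (E : set T) (M : matroid E) (X : set T) : set T :=
  [set e | X e \/ exists C, [/\ circuit M C, C e & C `\ e `<=` X]].

(* A set is independent in the dual when it lies in the complement of a base;
   base_dual below shows that the bases are then the complements of bases. *)
Definition dual_indep (T : Type) (E : set T) (M : matroid E) : set (set T) :=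
  [set I | exists B, base M B /\ I `<=` E `\` B].

Lemma base_ground (T : Type) (E : set T) (M : matroid E) B :
  base M B -> B `<=` E.
Proof. by case=> /indep_ground. Qed.

Lemma maximal_dual_indep (T : Type) (E : set T) (M : matroid E) (D : set T) :
  maximal_set (dual_indep M) D <-> exists B, base M B /\ D = E `\` B.
Proof.
split=> [[[B [bB DB]] maxD]|[B [bB ->]]].
  by exists B; split=> //; apply/esym/maxD => //; exists B; split.
split=> [|J [B' [bB' JB']] BJ]; first by exists B; split.
have sB : B' `<=` B.
  move=> x B'x; apply: contrapT => nBx.
  by have [] := JB' x (BJ x (conj (base_ground bB' B'x) nBx)).
have eB : B = B' by case: bB' => _; apply=> //; case: bB.
by apply/seteqP; split=> //; rewrite eB.
Qed.

Lemma base_max_in (T : Type) (E : set T) (M : matroid E) X B K :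
  base M B -> B `<=` X ->
  maximal_set [set K | indep M K /\ K `<=` X] K -> base M K.
Proof.
move=> bB BX [[iK KX] maxK]; apply: contrapT => nK.
have [e [[Be nKe] ieK]] := indep_augment iK nK bB.
apply: nKe; rewrite -(maxK (e |` K)); first by left.
- by split=> // x [->|/KX//]; apply: BX.
- by move=> x; right.
Qed.

Section DualAxioms.
Context (T : Type) (E : set T) (M : matroid E).

Lemma dual_indep_ground I : dual_indep M I -> I `<=` E.
Proof. by move=> [B [_ IB]] x /IB[]. Qed.

Lemma dual_indep_set0 : dual_indep M set0.
Proof.
have [B [_ mB]] := indep_extend (@subset_refl _ E) (indep_set0 M) (@sub0set _ E).
exists B; split=> //; split=> [|J iJ BJ]; first by case: mB => -[].
by case: mB => _; apply=> //; split=> //; apply: indep_ground iJ.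
Qed.

Lemma dual_indep_subset I J : dual_indep M J -> I `<=` J -> dual_indep M I.
Proof. by move=> [B [bB JB]] IJ; exists B; split=> // x /IJ/JB. Qed.

Lemma dual_indep_augment I J : dual_indep M I -> ~ maximal_set (dual_indep M) I ->
  maximal_set (dual_indep M) J ->
  exists e, (J `\` I) e /\ dual_indep M (e |` I).
Proof.
move=> [B1 [bB1 IB1]] nI /maximal_dual_indep[B [bB ->]].
have [x [[Ex nB1x] nIx]] : exists x, (E `\` B1) x /\ ~ I x.
  apply: contrapT => nex; apply: nI; apply/maximal_dual_indep.
  exists B1; split=> //; apply/seteqP; split=> // x Bx.
  by apply: contrapT => nIx; apply: nex; exists x.
have [Bx|nBx] := pselect (B x); last first.
  by exists x; split=> //; exists B1; split=> // y [->|/IB1].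
have [|y [By nIy]|B2 [BB2 mB2]] :=
  @indep_extend _ _ M (E `\` I) (B `\` I) (@subDsetl _ E I).
- by case: bB => iB _; apply: indep_subset iB (@subDsetl _ B I).
- by split=> //; apply: (base_ground bB).
have B1I : B1 `<=` E `\` I.
  by move=> y B1y; split; [apply: (base_ground bB1)|move=> /IB1[]].
have bB2 := base_max_in bB1 B1I mB2.
have [e [B1e nB2e]] : exists e, B1 e /\ ~ B2 e.
  apply: contrapT => nex; apply: nB1x.
  have -> : B1 = B2; last by apply: BB2.
  apply/esym; case: bB1 => _; apply; first by case: bB2.
  by move=> y B1y; apply: contrapT => nB2y; apply: nex; exists y.
have [Ee nIe] := B1I e B1e.
exists e; split.
  by split=> //; split=> // Be; apply: nB2e; apply: BB2.
exists B2; split=> // y [->//|Iy]; split; first by have [Ey] := IB1 y Iy.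
by case: mB2 => -[_ B2I] _ /B2I[].
Qed.

Lemma dual_indep_extend X I : X `<=` E -> dual_indep M I -> I `<=` X ->
  exists J, I `<=` J /\ maximal_set [set K | dual_indep M K /\ K `<=` X] J.
Proof.
move=> XE [B [bB IB]] IX.
have [J [_ [[iJ JY] maxJ]]] :=
  indep_extend (@subDsetl _ E X) (indep_set0 M) (@sub0set _ (E `\` X)).
have JI : J `<=` E `\` I by move=> x /JY[Ex nXx]; split=> // /IX.
have [K [JK mK]] := indep_extend (@subDsetl _ E I) iJ JI.
have bK : base M K.
  apply: (base_max_in bB _ mK) => x Bx; split; first exact: (base_ground bB).
  by move=> /IB[].
have iK : indep M K by case: bK.
exists (X `\` K); split.
  by move=> x Ix; split; [apply: IX|case: mK => -[_ KI] _ /KI[]].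
split=> [|L [[B' [bB' LB']] LX] KL].
  split; last exact: subDsetl.
  by exists K; split=> // x [/XE].
apply/seteqP; split=> // z Lz; split; first exact: LX.
move=> Kz.
have iKz : indep M (K `\ z) by apply: indep_subset iK (@subDsetl _ K _).
have nKz : ~ maximal_set (indep M) (K `\ z).
  move=> [_ /(_ K iK (@subDsetl _ K _)) KE].
  by move: Kz; rewrite KE => -[_]; apply.
have [e [[B'e nKze] ie]] := indep_augment iKz nKz bB'.
have nLe : ~ L e by move=> /LB'[].
have Ee := base_ground bB' B'e.
have nXe : ~ X e.
  move=> Xe; apply: nKze; split; last by move=> ez; apply: nLe; rewrite ez.
  by apply: contrapT => nKe; apply: nLe; apply: KL.
have JKz : J `<=` K `\ z.
  move=> x Jx; split; first exact: JK.
  by move=> xz; have [_] := JY x Jx; rewrite xz; apply; apply: LX.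
apply: nKze; apply: (JKz); rewrite -(maxJ (e |` J)); first by left.
- split; first by apply: (indep_subset ie); exact: (setUS JKz).
  by move=> x [->|/JY].
- by move=> x; right.
Qed.

End DualAxioms.

Definition dual (T : Type) (E : set T) (M : matroid E) : matroid E :=
  Matroid (@dual_indep_ground _ _ M) (@dual_indep_set0 _ _ M)
    (@dual_indep_subset _ _ M) (@dual_indep_augment _ _ M)
    (@dual_indep_extend _ _ M).

Lemma base_dual (T : Type) (E : set T) (M : matroid E) (D : set T) :
  base (dual M) D <-> exists B, base M B /\ D = E `\` B.
Proof. exact: maximal_dual_indep. Qed.

Definition finitary (T : Type) (E : set T) (M : matroid E) : Prop :=
  forall C, circuit M C -> finite_set C.

Definition cofinitary (T : Type) (E : set T) (M : matroid E) : Prop :=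
  finitary (dual M).

Definition is_direct_sum (T : Type) (E A B : set T)
    (M : matroid E) (MA : matroid A) (MB : matroid B) : Prop :=
  [/\ A `|` B = E, A `&` B = set0 &
      forall I, I `<=` E ->
        (indep M I <-> indep MA (I `&` A) /\ indep MB (I `&` B))].

(* Either part may be empty. *)
Definition sum_finitary_cofinitary (T : Type) (E : set T) (M : matroid E) : Prop :=
  exists (A B : set T) (MA : matroid A) (MB : matroid B),
    [/\ finitary MA, cofinitary MB & is_direct_sum M MA MB].

(* Main.v *)
(** For [D] and [S] disjoint in a finitary matroid, well-order [D] and let [G S]
    consist of the elements of [D] not spanned by [S] and the earlier elements of
    [D]: this is a base of [D] over [S], and it is antitone in [S].  The cofinitary
    case follows by duality, and the two combine along a direct sum.  The four
    conditions hold when [T i `\` R i] is the greedy set for [D = P i `\` R i] over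
    [T i `&` R i] in [M i], and symmetrically, with [P] and [R] exchanged, in [N e];
    such a [T] is a fixed point of a composition of two antitone maps, which
    Knaster-Tarski provides. *)
Require Import Defs.
From mathcomp Require Import all_boot.
From mathcomp Require Import boolp classical_sets functions cardinality.
From mathcomp Require wochoice.

Set Implicit Arguments.
Unset Strict Implicit.
Unset Printing Implicit Defensive.

Local Open Scope classical_set_scope.

(** * Well-orders and finite maxima *)

(** The strict part of a relation given by the well-ordering principle. Only least elements of
    nonempty sets are supplied, so the order axioms are read off from least elements of sets of at
    most three points. *)
Lemma well_founded_total_order (T : Type) : exists lt : T -> T -> Prop,
  [/\ well_founded lt, forall x y z, lt x y -> lt y z -> lt x z &
      forall x y, x <> y -> lt x y \/ lt y x].
Proof.
have [r wo_r] := wochoice.well_ordering_principle {classic T}.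
have min (A : set T) x : A x -> exists z, A z /\ forall y, A y -> r z y.
  move=> Ax.
  have [|z [[Az lbz] _]] := wo_r [pred y | `[< A y >]].
    by exists x; apply/asboolP.
  exists z; split; first by move: Az => /asboolP.
  by move=> y Ay; apply: lbz; apply/asboolP.
have anti x y : r x y -> r y x -> x = y.
  move=> xy yx; have refl z : r z z.
    by have [z' [z'z /(_ z erefl)]] := min [set z] z erefl; rewrite z'z.
  have [|z [_ uz]] := wo_r [pred z | `[< z = x \/ z = y >]].
    by exists x; apply/asboolP; left.
  have zx : z = x.
    apply: uz; split; first by apply/asboolP; left.
    by move=> w /asboolP[] ->.
  have zy : z = y.
    apply: uz; split; first by apply/asboolP; right.
    by move=> w /asboolP[] ->.
  by rewrite -zx.
have wf : well_founded (fun x y : T => r x y /\ x <> y).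
  move=> x; apply: contrapT => nx.
  have [z [nz minz]] := min [set y | ~ Acc (fun x y : T => r x y /\ x <> y) y] x nx.
  apply: nz; constructor=> y [yz nyz]; apply: contrapT => ny.
  by apply: nyz; apply: anti => //; apply: minz.
have tot x y : x <> y -> (r x y /\ x <> y) \/ (r y x /\ y <> x).
  move=> nxy; have [z [zxy minz]] := min [set z | z = x \/ z = y] x (or_introl erefl).
  have rx := minz x (or_introl erefl); have ry := minz y (or_intror erefl).
  by case: zxy rx ry => -> rx ry; [left|right]; split=> // yx; apply: nxy.
exists (fun x y => r x y /\ x <> y); split=> //.
move=> x y z xy yz.
have [t [txyz mint]] :=
  min [set t | [\/ t = x, t = y | t = z]] x (Or31 _ _ erefl).
have [nxy nyz] : x <> y /\ y <> z by case: xy yz => _ ? [].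
have tx := mint x (Or31 _ _ erefl); have ty := mint y (Or32 _ _ erefl).
have tz := mint z (Or33 _ _ erefl).
case: txyz tx ty tz => -> tx ty tz.
- by split=> // xz; apply: nxy; apply: anti => //; rewrite xz; case: yz.
- by case: nxy; apply: anti => //; case: xy.
- by case: nyz; apply: anti => //; case: yz.
Qed.

(** Picks the last greedily chosen element of a finite circuit; this is how finitariness enters the
    proof. *)
Lemma finite_set_max (T : Type) (lt : T -> T -> Prop) (A : set T) :
  (forall x y z, lt x y -> lt y z -> lt x z) ->
  (forall x y, x <> y -> lt x y \/ lt y x) ->
  finite_set A -> A !=set0 ->
  exists g, A g /\ forall f, A f -> f <> g -> lt f g.
Proof.
move=> trans tot finA.
have /(@finite_seqP {classic T})[s ->] : finite_set (A : set {classic T}) by [].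
elim: s => [[]//|x s IH _].
have [[y ys]|ns] := pselect ([set` s] !=set0); last first.
  exists x; split=> [|f]; first by rewrite /= inE eqxx.
  by rewrite /= inE => /orP[/eqP//|fs _]; case: ns; exists f.
have [g [gs maxg]] := IH (ex_intro _ y ys).
have [gx|ngx] := pselect (g = x).
  exists g; split=> [|f]; first by rewrite /= inE; apply/orP; right.
  by rewrite /= inE => /orP[/eqP->|/maxg//]; rewrite gx.
case: (tot _ _ ngx) => [ltgx|ltxg].
  exists x; split=> [|f]; first by rewrite /= inE eqxx.
  rewrite /= inE => /orP[/eqP//|fs _].
  by have [->//|nfg] := pselect (f = g); apply: trans ltgx; apply: maxg.
exists g; split=> [|f]; first by rewrite /= inE; apply/orP; right.
by rewrite /= inE => /orP[/eqP->//|/maxg].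
Qed.

(** * Circuits, cocircuits and span in infinite matroids *)

Lemma span_mono (T : Type) (E : set T) (M : matroid E) (X Y : set T) :
  X `<=` Y -> span M X `<=` span M Y.
Proof.
move=> XY e [Xe|[C [cC Ce CX]]]; first by left; apply: XY.
by right; exists C; split=> //; apply: subset_trans XY.
Qed.

(** A maximal independent subset of a set containing a base is itself a base. The upper bound on [K]
    is what the exchange arguments below exploit. *)
Lemma indep_extend_base (T : Type) (E : set T) (M : matroid E) I B :
  indep M I -> base M B ->
  exists K, [/\ base M K, I `<=` K & K `<=` I `|` B].
Proof.
move=> iI bB.
have sIB : I `|` B `<=` E.
  by move=> x [/(indep_ground iI)//|]; apply: (base_ground bB).
have [K [IK mK]] := indep_extend sIB iI (@subsetUl _ I B).
exists K; split=> //; last by case: mK => -[].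
by apply: (base_max_in bB _ mK); apply: subsetUr.
Qed.

Lemma base_exists (T : Type) (E : set T) (M : matroid E) : exists B, base M B.
Proof. by have [B [bB _]] := dual_indep_set0 M; exists B. Qed.

Lemma base_maximal (T : Type) (E : set T) (M : matroid E) B J :
  base M B -> indep M J -> B `<=` J -> J = B.
Proof. by move=> [_]; apply. Qed.

(* The circuit is [x] together with the [y] that [x] can replace in a base. *)
Lemma fundamental_circuit (T : Type) (E : set T) (M : matroid E) I x :
  indep M I -> E x -> ~ indep M (x |` I) ->
  exists C, [/\ circuit M C, C x & C `<=` x |` I].
Proof.
move=> iI Ex dI.
have [B0 bB0] := base_exists M.
have [B [bB IB _]] := indep_extend_base iI bB0.
have iB : indep M B by case: bB.
have dB : ~ indep M (x |` B).
  by move=> /indep_subset iB'; apply/dI/iB'/setUS.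
have nBx : ~ B x.
  move=> Bx; apply: dB; apply: (indep_subset iB) => y [->|] //.
pose C := [set y | y = x \/ B y /\ indep M (x |` (B `\ y))].
have CB : C `<=` x |` B by move=> y [->|[By _]]; [left|right].
exists C; split; last 2 first.
- by left.
- move=> y [->|[By iBy]]; first by left.
  apply: contrapT => nIy; apply: dI; apply: (indep_subset iBy) => z [->|Iz].
    by left.
  right; split; first exact: IB.
  by move=> zy; apply: nIy; right; rewrite -zy.
split=> [|D [DE dD] DC].
  split=> [y /CB[->//|]|iC]; first exact: (base_ground bB).
  (* An independent [C] would extend to a base [K] missing some [y] of [B]. Augmenting [B] without
     [y] from [K] can only add [x], which puts [y] in [C] and hence in [K]. *)
  have [K [bK CK KCB]] := indep_extend_base iC bB.
  have [y [By nKy]] : exists y, B y /\ ~ K y.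
    apply: contrapT => nex; apply: dB.
    apply: (indep_subset (proj1 bK)) => y [->|By]; first by apply: CK; left.
    by apply: contrapT => nKy; apply: nex; exists y.
  have iBy : indep M (B `\ y) by apply: indep_subset iB (@subDsetl _ B _).
  have nBy : ~ maximal_set (indep M) (B `\ y).
    move=> /(base_maximal) /(_ iB (@subDsetl _ B _)) BE.
    by move: By; rewrite BE => -[_]; apply.
  have [e [[Ke nBye] ie]] := indep_augment iBy nBy bK.
  have ex : e = x.
    have [/CB[//|Be]|Be] := KCB e Ke; case: nBye; split=> //;
      by move=> ey; apply: nKy; rewrite -ey.
  by apply: nKy; apply: CK; right; split=> //; rewrite -ex.
apply/seteqP; split=> // z Cz; apply: contrapT => nDz; apply: dD.
case: Cz => [zx|[Bz iBz]].
  apply: (indep_subset iB) => y Dy; have [yx|//] := CB _ (DC _ Dy).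
  by case: nDz; rewrite zx -yx.
apply: (indep_subset iBz) => y Dy; have [->|By] := CB _ (DC _ Dy); first by left.
by right; split=> // yz; apply: nDz; rewrite -yz.
Qed.

Lemma circuit_indepD1 (T : Type) (E : set T) (M : matroid E) C e :
  circuit M C -> C e -> indep M (C `\ e).
Proof.
move=> [[CE dC] minC] Ce; apply: contrapT => dCe.
have := minC (C `\ e) (conj (subset_trans (@subDsetl _ C _) CE) dCe)
  (@subDsetl _ C _).
by move=> CeC; move: Ce; rewrite -CeC => -[_]; apply.
Qed.

(** Take a base [B] avoiding [D] minus [e], and extend [C] minus [e] to a base [K] using only
    elements of [B]. Then [K] misses [e], since it would otherwise contain [C]; so it misses all of
    [D], which makes [D] coindependent. *)
Lemma circuit_cocircuit (T : Type) (E : set T) (M : matroid E) C D e :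
  circuit M C -> circuit (dual M) D -> C `&` D <> [set e].
Proof.
move=> cC cD CDe.
have [Ce De] : (C `&` D) e by rewrite CDe.
have [B [bB DB]] := circuit_indepD1 cD De.
have [K [bK CK KCB]] := indep_extend_base (circuit_indepD1 cC Ce) bB.
have nKe : ~ K e.
  move=> Ke; case: cC => -[_ dC] _; apply: dC.
  apply: (indep_subset (proj1 bK)) => y Cy.
  by have [->//|nye] := pselect (y = e); apply: CK; split.
case: cD => -[DE dD] _; apply: dD; exists K; split=> // y Dy.
split; first exact: DE.
move=> Ky; have nye : y <> e by move=> ye; apply: nKe; rewrite -ye.
have [[Cy _]|By] := KCB y Ky.
  by apply: nye; have : (C `&` D) y by []; rewrite CDe.
by have [|_] := DB y; first by split.
Qed.

(** With circuit-cocircuit orthogonality, this turns every failure to span into a cocircuit, so span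
    arguments can do without circuit elimination. *)
Lemma span_or_cospan (T : Type) (E : set T) (M : matroid E) (X : set T) e :
  E e -> X `<=` E -> span M X e \/ span (dual M) ((E `\` X) `\ e) e.
Proof.
move=> Ee XE; have [Xe|nXe] := pselect (X e); first by left; left.
pose Y := (E `\` X) `\ e.
have YE : Y `<=` E by move=> y [[]].
have [I [_ [[iI IX] maxI]]] :=
  indep_extend XE (indep_set0 M) (@sub0set _ X).
have [J [_ [[iJ JY] maxJ]]] :=
  indep_extend YE (indep_set0 (dual M)) (@sub0set _ Y).
have [iIe|dIe] := pselect (indep M (e |` I)); last first.
  left; right; have [C [cC Ce CI]] := fundamental_circuit iI Ee dIe.
  by exists C; split=> // y [/CI[->|/IX]] // /(_ erefl).
have [[B [bB JeB]]|dJe] := pselect (indep (dual M) (e |` J)); last first.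
  right; right; have [C [cC Ce CJ]] := fundamental_circuit iJ Ee dJe.
  by exists C; split=> // y [/CJ[->|/JY]] // /(_ erefl).
(* Both [I] and [J] now extend by [e]. The base [K] avoids [e], while the base [L] contains [e] and
   so loses some [y] of [K]. This [y] lies outside [X], and [L] avoids [J] together with [y],
   against the maximality of [J]. *)
have [K [bK IK KIB]] := indep_extend_base iI bB.
have nKe : ~ K e.
  move=> /KIB[/IX//|Be].
  by have [|_] := JeB e; first by left.
have [L [bL eIL LeIK]] := indep_extend_base iIe bK.
have [y [Ky nLy]] : exists y, K y /\ ~ L y.
  apply: contrapT => nex; apply: nKe.
  have <- : L = K; last by apply: eIL; left.
  apply: (base_maximal bK); first by case: bL.
  by move=> y Ky; apply: contrapT => nLy; apply: nex; exists y.
have nIy : ~ I y by move=> Iy; apply: nLy; apply: eIL; right.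
have Ey := base_ground bK Ky.
have ye : y <> e by move=> ye; apply: nKe; rewrite -ye.
have nXy : ~ X y.
  move=> Xy; apply: nIy; rewrite -(maxI (y |` I)); first by left.
  - split; last by move=> z [->|/IX].
    by apply: (indep_subset (proj1 bK)) => z [->|/IK].
  - exact: subsetUr.
have By : B y by case: (KIB y Ky).
have nJy : ~ J y by move=> Jy; have [|_] := JeB y; first by right.
case: nJy; rewrite -(maxJ (y |` J)); first by left.
- split; last by move=> z [->|/JY].
  exists L; split=> // z [->|Jz]; first by [].
  have [|Ez nBz] := JeB z; first by right.
  have [[_ nXz] nze] := JY z Jz.
  by split=> // /LeIK[[//|/IX//]|/KIB[/IX//|//]].
- exact: subsetUr.
Qed.

(** If [X] does not span [e], some cocircuit [D] through [e] avoids [X]. A circuit through [e] with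
    its other elements in [Y] meets [D] in a second element [y], and a circuit spanning [y] from [X]
    meets [D] only in [y]. *)
Lemma span_idem (T : Type) (E : set T) (M : matroid E) (X Y : set T) :
  X `<=` E -> Y `<=` span M X -> span M Y `<=` span M X.
Proof.
move=> XE YX e [/YX//|[C [cC Ce CY]]].
have Ee : E e by case: cC => -[CE _] _; apply: CE.
case: (span_or_cospan M Ee XE) => // -[[_ []]//|[D [cD De DX]]].
have [Xe|nXe] := pselect (X e); first by left.
have nDX y : D y -> ~ X y.
  move=> Dy; have [->//|nye] := pselect (y = e).
  by have [|[_ nXy] _] := DX y.
exfalso; apply: (circuit_cocircuit (e := e) cC cD).
apply/seteqP; split=> [y [Cy Dy]|y ->//].
apply: contrapT => nye; have [|Xy|[C' [cC' C'y C'X]]] := YX y.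
- by apply: CY.
- exact: nDX Dy Xy.
- apply: (circuit_cocircuit (e := y) cC' cD).
  apply/seteqP; split=> [z [C'z Dz]|z ->//]; apply: contrapT => nzy.
  by apply: (nDX z Dz); apply: C'X.
Qed.

(** * Greedy selections in finitary and cofinitary matroids *)

(* A relative base of [D] over [S], chosen antitonically in [S]. *)
Definition greedy_selection (T : Type) (E : set T) (M : matroid E) (D : set T)
    (G : set T -> set T) : Prop :=
  [/\ forall S S', S `<=` S' -> G S' `<=` G S,
      forall S, G S `<=` D &
      forall S, S `<=` E -> S `&` D = set0 ->
        D `<=` span M (S `|` G S) /\
        G S `<=` span (dual M) (E `\` (S `|` G S))].

(** The test is against all earlier elements of [D], selected or not. This avoids recursion and
    makes antitonicity in [S] a consequence of the monotonicity of [span]. *)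
Definition greedy_set (T : Type) (E : set T) (M : matroid E)
    (lt : T -> T -> Prop) (D S : set T) : set T :=
  [set e | D e /\ ~ span M (S `|` [set f | D f /\ lt f e]) e].

Lemma greedy_set_antitone (T : Type) (E : set T) (M : matroid E) lt D S S' :
  S `<=` S' -> greedy_set M lt D S' `<=` greedy_set M lt D S.
Proof.
by move=> SS' e [De nse]; split=> // se; apply: nse; apply: span_mono se; apply: setSU.
Qed.

(** Well-founded induction: a rejected element is spanned by [S] and earlier elements of [D], which
    are spanned already, and span is idempotent. *)
Lemma greedy_set_span (T : Type) (E : set T) (M : matroid E) lt D S :
  well_founded lt -> S `<=` E -> D `<=` E ->
  D `<=` span M (S `|` greedy_set M lt D S).
Proof.
move=> wf SE DE e; elim/(well_founded_ind wf): e => e IH De.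
have [se|nse] := pselect (span M (S `|` [set f | D f /\ lt f e]) e); last first.
  by left; right; split.
apply: span_idem se; first by move=> y [/SE//|[/DE]].
move=> f [Sf|[Df ltfe]]; first by left; left.
exact: IH.
Qed.

(** A circuit violating this is finite, so it has a last greedy element [g], possibly different from
    [e]. Its other elements lie in [S] or come earlier in [D], so [g] should have been rejected. *)
Lemma greedy_set_indep (T : Type) (E : set T) (M : matroid E) lt D S e :
  finitary M -> (forall x y z, lt x y -> lt y z -> lt x z) ->
  (forall x y, x <> y -> lt x y \/ lt y x) ->
  S `&` D = set0 -> greedy_set M lt D S e ->
  ~ span M ((S `|` greedy_set M lt D S) `\ e) e.
Proof.
move=> finM trans tot SD Ge [[_ /(_ erefl)//]|[C [cC Ce CSG]]].
set G := greedy_set M lt D S in Ge CSG *.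
have [|g [[Cg Gg] maxg]] :=
  @finite_set_max T lt (C `&` G) trans tot _ (ex_intro _ e (conj Ce Ge)).
  by apply: finite_setIl; apply: finM.
case: (Gg) => Dg; apply; right; exists C; split=> // f [Cf nfg].
have [Gf|nGf] := pselect (G f).
  by right; split; [case: Gf|apply: maxg].
have nfe : f <> e by move=> fe; apply: nGf; rewrite fe.
by left; have [|[]] := CSG f.
Qed.

Lemma greedy_finitary (T : Type) (E : set T) (M : matroid E) (D : set T) :
  finitary M -> D `<=` E -> exists G, greedy_selection M D G.
Proof.
move=> finM DE; have [lt [wf trans tot]] := well_founded_total_order T.
exists (greedy_set M lt D).
split=> [S1 S2|S e []//|S SE SD]; first exact: greedy_set_antitone.
split; first exact: greedy_set_span.
move=> e Ge; set X := S `|` _.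
have XE : X `\ e `<=` E by move=> y [[/SE//|[/DE//]]].
have Ee : E e by case: Ge => /DE.
(* Independence over the rest of [X] becomes cospanning by the complement of [X]. *)
case: (span_or_cospan M Ee XE) => [|spe].
  by move/(greedy_set_indep finM trans tot SD Ge).
apply: span_mono spe => y [[Ey nXy] nye]; split=> // Xy.
by apply: nXy; split.
Qed.

(* Select the part of [D] rejected by the greedy choice in the dual over the
   complement of [S `|` D]. *)
Lemma greedy_cofinitary (T : Type) (E : set T) (M : matroid E) (D : set T) :
  cofinitary M -> D `<=` E -> exists G, greedy_selection M D G.
Proof.
move=> finM DE; have [lt [wf trans tot]] := well_founded_total_order T.
pose S' (S : set T) := E `\` (S `|` D).
pose H S := greedy_set (dual M) lt D (S' S).
exists (fun S => D `\` H S); split; last 2 first.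
- by move=> S; apply: subDsetl.
- move=> S SE SD.
  have S'E : S' S `<=` E by apply: subDsetl.
  have S'D : S' S `&` D = set0.
    by rewrite -subset0 => y [[_ nSDy] Dy]; apply: nSDy; right.
  split.
  + move=> e De; have [He|nHe] := pselect (H S e); last by left; right.
    set X := S `|` _.
    have XE : X `<=` E by move=> y [/SE//|[/DE]].
    (* Otherwise [e] is cospanned by elements of [S' S] and other elements of [H S], contradicting
       greedy independence in the dual. *)
    case: (span_or_cospan M (DE e De) XE) => // spe.
    exfalso; apply: (greedy_set_indep finM trans tot S'D He).
    apply: span_mono spe => y [[Ey nXy] nye]; split=> //.
    have [Dy|nDy] := pselect (D y).
      by right; apply: contrapT => nHy; apply: nXy; right.
    by left; split=> // -[Sy|//]; apply: nXy; left.
  + move=> e [De _]; have := greedy_set_span (dual M) wf S'E DE De.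
    apply: span_mono => y [[Ey nSDy]|Hy].
      by split=> // -[Sy|[Dy _]]; apply: nSDy; [left|right].
    have Dy : D y by case: Hy.
    split; first exact: DE.
    move=> [Sy|[_ //]].
    by have : (S `&` D) y by []; rewrite SD.
(* Three inclusion reversals compose: [S'], the greedy set, and the complement in [D]. *)
- move=> S1 S2 S12 e [De nHe]; split=> // He; apply: nHe.
  apply: greedy_set_antitone He => y [Ey nSDy]; split=> // -[Sy|Dy]; apply: nSDy.
    by left; apply: S12.
  by right.
Qed.

(** * Direct sums, their duals, and greedy selections in them *)

Section DirectSum.
Context (T : Type) (E A B : set T).
Context (M : matroid E) (MA : matroid A) (MB : matroid B).
Context (sumM : is_direct_sum M MA MB).

Lemma is_direct_sumC : is_direct_sum M MB MA.
Proof.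
case: sumM => AB AB0 iM; split; first by rewrite setUC.
  by rewrite setIC.
by move=> I IE; rewrite iM //; split=> -[].
Qed.

Lemma circuit_summand C : circuit MA C -> circuit M C.
Proof.
case: sumM => AB AB0 iM [[CA dC] minC].
have AE : A `<=` E by rewrite -AB; apply: subsetUl.
split=> [|D [DE dD] DC].
  split; first exact: subset_trans AE.
  move=> /(proj1 (iM C (subset_trans CA AE)))[].
  by rewrite (setIidl CA).
apply: minC => //; split; first exact: subset_trans CA.
move=> iD; apply: dD; apply/(iM D DE); split.
  by apply: indep_subset iD _; apply: subIsetl.
apply: (indep_subset (indep_set0 MB)) => y [Dy By].
by rewrite -AB0; split=> //; apply: CA; apply: DC.
Qed.

Lemma span_summand X : span MA X `<=` span M X.
Proof.
move=> e [Xe|[C [cC Ce CX]]]; first by left.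
by right; exists C; split=> //; apply: circuit_summand.
Qed.

(** Needed because coindependence is defined through bases: it lets witnessing bases be restricted
    to the summands and reunited. *)
Lemma base_direct_sum X : X `<=` E ->
  (base M X <-> base MA (X `&` A) /\ base MB (X `&` B)).
Proof.
case: sumM => AB AB0 iM.
have AE : A `<=` E by rewrite -AB; apply: subsetUl.
have BE : B `<=` E by rewrite -AB; apply: subsetUr.
have disj x : A x -> B x -> False.
  by move=> Ax Bx; have : (A `&` B) x by []; rewrite AB0.
have split_set Y Z : Y `<=` A -> Z `<=` B ->
    (Y `|` Z) `&` A = Y /\ (Y `|` Z) `&` B = Z.
  move=> YA ZB; split; apply/seteqP; split=> x.
  - by move=> [[//|/ZB Bx] Ax]; case: (disj x).
  - by move=> Yx; split; [left|apply: YA].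
  - by move=> [[/YA Ax|//] Bx]; case: (disj x).
  - by move=> Zx; split; [right|apply: ZB].
have recover Y : Y `<=` E -> Y = (Y `&` A) `|` (Y `&` B).
  by move=> YE; rewrite -setIUr AB (setIidl YE).
have join Y Z : indep MA Y -> indep MB Z -> indep M (Y `|` Z).
  move=> iY iZ; have [YA ZB] := (indep_ground iY, indep_ground iZ).
  have [e1 e2] := split_set Y Z YA ZB.
  by apply/iM; [move=> x [/YA/AE|/ZB/BE]|rewrite e1 e2].
move=> XE; split=> [bX|[bXA bXB]].
  have [iXA iXB] := proj1 (iM X XE) (proj1 bX).
  split; split=> // J iJ XJ.
  - have [e1 _] := split_set J (X `&` B) (indep_ground iJ) (@subIsetr _ X B).
    rewrite -e1 (base_maximal bX (join J (X `&` B) iJ iXB)) //.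
    by rewrite {1}(recover X XE); apply: setSU.
  - have [_ e1] := split_set (X `&` A) J (@subIsetr _ X A) (indep_ground iJ).
    rewrite -e1 (base_maximal bX (join (X `&` A) J iXA iJ)) //.
    by rewrite {1}(recover X XE); apply: setUS.
split; first by apply/(iM X XE); split; [case: bXA|case: bXB].
move=> J iJ XJ; have JE := indep_ground iJ.
have [iJA iJB] := proj1 (iM J JE) iJ.
rewrite (recover J JE) (recover X XE).
by congr (_ `|` _); [apply: (base_maximal bXA)|apply: (base_maximal bXB)] => //;
  apply: setSI.
Qed.

End DirectSum.

Lemma is_direct_sum_dual (T : Type) (E A B : set T) (M : matroid E)
    (MA : matroid A) (MB : matroid B) :
  is_direct_sum M MA MB -> is_direct_sum (dual M) (dual MA) (dual MB).
Proof.
move=> sumM; case: (sumM) => AB AB0 iM; split=> // I IE.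
have AE : A `<=` E by rewrite -AB; apply: subsetUl.
have BE : B `<=` E by rewrite -AB; apply: subsetUr.
have disj x : A x -> B x -> False.
  by move=> Ax Bx; have : (A `&` B) x by []; rewrite AB0.
split=> [[K [bK IK]]|[[K [bK IK]] [L [bL IL]]]].
  have [bKA bKB] := proj1 (base_direct_sum sumM (base_ground bK)) bK.
  split; [exists (K `&` A)|exists (K `&` B)]; split=> // x [/IK[_ nKx] ?];
    by split=> // -[].
have [KA LB] := (base_ground bK, base_ground bL).
exists (K `|` L); split; last first.
  move=> x Ix; split; first exact: IE.
  move=> [Kx|Lx].
    by have [|_] := IK x; first by split=> //; apply: KA.
  by have [|_] := IL x; first by split=> //; apply: LB.
apply/(base_direct_sum sumM); first by move=> x [/KA/AE|/LB/BE].
suff [-> ->] : (K `|` L) `&` A = K /\ (K `|` L) `&` B = L by [].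
split; apply/seteqP; split=> x.
- by move=> [[//|/LB Bx] Ax]; case: (disj x).
- by move=> Kx; split; [left|apply: KA].
- by move=> [[/KA Ax|//] Bx]; case: (disj x).
- by move=> Lx; split; [right|apply: LB].
Qed.

(** The union of selections made separately in the two parts works, because circuits of a summand
    are circuits of the sum, and likewise for the duals. *)
Lemma greedy_sum (T : Type) (E : set T) (M : matroid E) (D : set T) :
  sum_finitary_cofinitary M -> D `<=` E -> exists G, greedy_selection M D G.
Proof.
move=> [A [B [MA [MB [finA cofB sumM]]]]] DE.
have sumM' := is_direct_sumC sumM.
have dsumM := is_direct_sum_dual sumM; have dsumM' := is_direct_sumC dsumM.
have [AB AB0 _] := sumM.
have AE : A `<=` E by rewrite -AB; apply: subsetUl.
have BE : B `<=` E by rewrite -AB; apply: subsetUr.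
have disj x : A x -> B x -> False.
  by move=> Ax Bx; have : (A `&` B) x by []; rewrite AB0.
have [GA [antiA GDA selA]] := greedy_finitary (D := D `&` A) finA (@subIsetr _ D A).
have [GB [antiB GDB selB]] := greedy_cofinitary (D := D `&` B) cofB (@subIsetr _ D B).
exists (fun S => GA (S `&` A) `|` GB (S `&` B)); split.
- by move=> S S' SS'; apply: setUSS; [apply: antiA|apply: antiB]; apply: setSI.
- by move=> S x [/GDA[]|/GDB[]].
move=> S SE SD.
have disjD X : (S `&` X) `&` (D `&` X) = set0.
  by rewrite -subset0 -SD => x [[? _] [? _]].
have [spA cospA] := selA (S `&` A) (@subIsetr _ S A) (disjD A).
have [spB cospB] := selB (S `&` B) (@subIsetr _ S B) (disjD B).
split.
- move=> x Dx; have : (A `|` B) x by rewrite AB; apply: DE.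
  case=> [Ax|Bx].
    apply: span_mono (span_summand sumM (spA _ (conj Dx Ax))).
    by move=> y [[Sy _]|Gy]; [left|right; left].
  apply: span_mono (span_summand sumM' (spB _ (conj Dx Bx))).
  by move=> y [[Sy _]|Gy]; [left|right; right].
- move=> x [Gx|Gx].
    apply: span_mono (span_summand dsumM (cospA _ Gx)).
    (* The selection in [B] is disjoint from [A], so a complement taken inside [A] stays in the
       complement of the whole selection. *)
    move=> y [Ay nSGy]; split; first exact: AE.
    move=> [Sy|[Gy|/GDB[_ By]]].
    + by apply: nSGy; left.
    + by apply: nSGy; right.
    + exact: disj y Ay By.
  apply: span_mono (span_summand dsumM' (cospB _ Gx)).
  move=> y [By nSGy]; split; first exact: BE.
  move=> [Sy|[/GDA[_ Ay]|Gy]].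
  + by apply: nSGy; left.
  + exact: disj y Ay By.
  + by apply: nSGy; right.
Qed.

(** * The fixed point and the sets [T i] *)

(** The union [X] of all [Y] contained in [f Y] is contained in [f X]; by monotonicity [f X] is then
    one of these sets. *)
Lemma monotone_fixpoint (T : Type) (f : set T -> set T) :
  (forall X Y, X `<=` Y -> f X `<=` f Y) -> exists X, f X = X.
Proof.
move=> mono; pose X := \bigcup_(Y in [set Y | Y `<=` f Y]) Y.
have XfX : X `<=` f X.
  by move=> x [Y YfY Yx]; apply: (mono Y); [apply: bigcup_sup|apply: YfY].
exists X; apply/seteqP; split=> //.
by apply: bigcup_sup; apply: mono.
Qed.

Theorem theorem1p7 (E Theta : Type)
    (M : Theta -> matroid [set: E]) (N : E -> matroid [set: Theta])
    (P R : Theta -> set E)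
    (hM : forall i : Theta, sum_finitary_cofinitary (M i))
    (hN : forall e : E, sum_finitary_cofinitary (N e)) :
  exists T : Theta -> set E,
    [/\ forall i : Theta, T i `<=` P i `|` R i,
        forall i : Theta, P i `<=` span (M i) (T i),
        forall i : Theta, ~` R i `<=` span (dual (M i)) (~` T i),
        forall e : E, [set i | R i e] `<=` span (N e) [set i | T i e] &
        forall e : E,
          [set i | ~ P i e] `<=` span (dual (N e)) [set i | ~ T i e]].
Proof.
have /choice[G selG] i : exists G, greedy_selection (M i) (P i `\` R i) G.
  exact: greedy_sum.
have /choice[H selH] e :
    exists H, greedy_selection (N e) [set i | R i e /\ ~ P i e] H.
  exact: greedy_sum.
(* [Q] is put into [T] outright. [X] will be the part of [T] in [P] but not [R], chosen by the
   [M i], and [Y X] the part in [R] but not [P], chosen by the [N e] in response to [X]. *)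
pose Q i e := P i e /\ R i e.
pose Y (X : set (Theta * E)) e := H e [set i | Q i e \/ X (i, e)].
have [X fixX] : exists X : set (Theta * E),
    [set p | G p.1 [set e | Q p.1 e \/ Y X e p.1] p.2] = X.
  apply: monotone_fixpoint => X1 X2 X12 [i e] /=.
  have [antiG _ _] := selG i; apply: antiG => e' [Qe|Ye]; first by left.
  right; have [antiH _ _] := selH e'; apply: antiH Ye => i' [Qi|Xi].
    by left.
  by right; apply: X12.
have XE i e : X (i, e) = G i [set e | Q i e \/ Y X e i] e by rewrite -{1}fixX.
have XPR i e : X (i, e) -> P i e /\ ~ R i e.
  by rewrite XE; have [_ GD _] := selG i; apply: GD.
have YRP i e : Y X e i -> R i e /\ ~ P i e.
  by have [_ HD _] := selH e; apply: HD.
(* Here [Q] and [Y X] together form the part of [T i] inside [R i], over which [G i] selects. *)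
have selX i : P i `\` R i `<=` span (M i) [set e | (Q i e \/ Y X e i) \/ X (i, e)] /\
    [set e | X (i, e)] `<=`
      span (dual (M i)) (~` [set e | (Q i e \/ Y X e i) \/ X (i, e)]).
  have [_ _ /(_ [set e | Q i e \/ Y X e i])[//||spG cospG]] := selG i.
    by rewrite -subset0 => e [[[_ Re]|/YRP[Re _]] [_ nRe]].
  have -> : [set e | X (i, e)] = G i [set e | Q i e \/ Y X e i].
    by apply/seteqP; split=> e; rewrite /= XE.
  split=> e.
    move=> /spG; apply: span_mono => f [?|Gf]; first by left.
    by right; rewrite XE.
  move=> /cospG; apply: span_mono => f [_ nf] [?|Xf]; apply: nf; first by left.
  by right; rewrite -XE.
have selY e : [set i | R i e /\ ~ P i e]
      `<=` span (N e) [set i | (Q i e \/ X (i, e)) \/ Y X e i] /\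
    Y X e `<=` span (dual (N e)) (~` [set i | (Q i e \/ X (i, e)) \/ Y X e i]).
  have [_ _ /(_ [set i | Q i e \/ X (i, e)])[//||spH cospH]] := selH e.
    by rewrite -subset0 => i [[[Pe _]|/XPR[Pe _]] [_ nPe]].
  by split=> // i /cospH; apply: span_mono => j [].
pose T i e := [\/ Q i e, X (i, e) | Y X e i].
exists T; split.
- by move=> i e [[? _]|/XPR[]|/YRP[]]; [left|left|right].
- move=> i e Pe; have [Re|nRe] := pselect (R i e); first by left; apply: Or31.
  apply: span_mono ((selX i).1 e (conj Pe nRe)) => f.
  by case=> [[]|]; [apply: Or31|apply: Or33|apply: Or32].
(* Elements outside [T i] are spanned trivially; those in [T i] but outside [R i] come from [X],
   which is cospanned by the complement of [T i]. *)
- move=> i e nRe; have [Te|nTe] := pselect (T i e); last by left.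
  case: Te => [[]//|Xe|/YRP[]//].
  apply: span_mono ((selX i).2 e Xe) => f nf Tf; apply: nf.
  by case: Tf => ?; [left; left|right|left; right].
- move=> e i Re; have [Pe|nPe] := pselect (P i e); first by left; apply: Or31.
  apply: span_mono ((selY e).1 i (conj Re nPe)) => j.
  by case=> [[]|]; [apply: Or31|apply: Or32|apply: Or33].
- move=> e i nPe; have [Te|nTe] := pselect (T i e); last by left.
  case: Te => [[]//|/XPR[]//|Ye].
  apply: span_mono ((selY e).2 i Ye) => j nj Tj; apply: nj.
  by case: Tj => ?; [left; left|left; right|right].
Qed.
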